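(* Let $G$ be an $n$-vertex caterpillar with $r$ non-leaf vertices, where $r\le (n-6)/2$. Then $G$ is reconstructible from its deck $\mathcal D(G)$: every graph $H$ with $\mathcal D(H)=\mathcal D(G)$ is isomorphic to $G$.
   Context: A caterpillar is a tree in which the subgraph induced by the non-leaf vertices is a path (the spine). For an $n$-vertex graph $G$, the deck $\mathcal D(G)$ is the multiset of all induced subgraphs of $G$ (each up to isomorphism) having at most $(n+2)/2$ vertices. *)

(* Defs.v *)
From HB Require Import structures.
From mathcomp Require Import all_boot.

Set Implicit Arguments.
Unset Strict Implicit.
Unset Printing Implicit Defensive.

(** Finite simple graphs. *)
Record sgraph := SGraph {
  svertex :> finType;
  adj : rel svertex;
  adj_sym : symmetric adj;
  adj_irrefl : irreflexive adj }.

Arguments adj {s}.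

Definition isomorphic (G H : sgraph) : Prop :=
  exists2 f : G -> H, bijective f & forall x y, adj (f x) (f y) = adj x y.

Definition isomorphicb (G H : sgraph) : bool :=
  [exists f : {ffun G -> H},
     [&& #|G| == #|H|, injectiveb f &
         [forall x, forall y, adj (f x) (f y) == adj x y]]].

Lemma isomorphicP (G H : sgraph) :
  reflect (isomorphic G H) (isomorphicb G H).
Proof.
apply: (iffP existsP) => [[f /and3P[/eqP eqGH /injectiveP f_inj adjf]]|].
  exists f; first by apply: inj_card_bij; rewrite ?eqGH.
  by move=> x y; apply/eqP; apply: (forallP (forallP adjf x) y).
move=> [f f_bij adjf]; exists (finfun f); apply/and3P; split.
- by apply/eqP; apply: bij_eq_card f_bij.
- by apply/injectiveP => x y; rewrite !ffunE; apply: bij_inj.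
- by apply/forallP=> x; apply/forallP=> y; rewrite !ffunE adjf.
Qed.

Section Induced.
Variables (G : sgraph) (S : {set G}).

Definition induced_adj : rel {x : G | x \in S} :=
  fun x y => adj (val x) (val y).

Lemma induced_adj_sym : symmetric induced_adj.
Proof. by move=> x y; apply: adj_sym. Qed.

Lemma induced_adj_irrefl : irreflexive induced_adj.
Proof. by move=> x; apply: adj_irrefl. Qed.

Definition induced : sgraph := SGraph induced_adj_sym induced_adj_irrefl.
End Induced.

Section PathGraph.
Variable r : nat.

Definition path_adj : rel 'I_r :=
  fun i j => (i.+1 == j :> nat) || (j.+1 == i :> nat).

Lemma path_adj_sym : symmetric path_adj.
Proof. by move=> i j; rewrite /path_adj orbC. Qed.

Lemma path_adj_irrefl : irreflexive path_adj.
Proof. by move=> i; rewrite /path_adj orbb gtn_eqF. Qed.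

Definition path_graph : sgraph := SGraph path_adj_sym path_adj_irrefl.
End PathGraph.

Definition degree (G : sgraph) (x : G) : nat := #|[set y | adj x y]|.

Definition nonleaves (G : sgraph) : {set G} := [set x | degree x != 1].

Definition connected_graph (G : sgraph) : Prop :=
  0 < #|G| /\ forall x y : G, connect adj x y.

(** [ucycle] also holds of the empty, one- and two-vertex sequences, which
    are not graph cycles (a single edge [x y] gives [ucycle adj [:: x; y]]). *)
Definition acyclic (G : sgraph) : Prop :=
  forall c : seq G, 3 <= size c -> ~ ucycle adj c.

Definition is_tree (G : sgraph) : Prop := connected_graph G /\ acyclic G.

Definition is_caterpillar (G : sgraph) : Prop :=
  is_tree G /\
  exists k : nat, isomorphic (induced (nonleaves G)) (path_graph k).

(** The multiset of isomorphism classes of induced subgraphs of [G] with at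
    most [(#|G| + 2) / 2] vertices, as a multiplicity function:
    [deck G K] is the number of such subgraphs that are isomorphic to [K]. *)
Definition deck (G : sgraph) (K : sgraph) : nat :=
  #|[set S : {set G} | (2 * #|S| <= #|G| + 2) && isomorphicb (induced S) K]|.

(* Main.v *)
Require Import Defs.
From HB Require Import structures.
From mathcomp Require Import all_boot zify.

Set Implicit Arguments.
Unset Strict Implicit.
Unset Printing Implicit Defensive.

(** The deck determines the number of tuples of at most (n+2)/2 vertices that
    satisfy any condition on the subgraph they induce. In G the induced paths on
    r+2 vertices are exactly those whose interior is the spine, traversed in
    either direction. Since r+4 <= (n+2)/2, for such a path x in H two extra
    vertices can be counted as well; this shows that the vertices off the
    interior X of x are independent and have at most one neighbour in X, and
    comparing the sums over all x of the degrees of X shows that each has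
    exactly one. So H is a caterpillar with spine X. Finally the sums over all x
    of deg x_i and of deg x_i * deg x_j agree in G and H, which determines the
    sequence of spine degrees up to reversal, hence the isomorphism type. *)

(** * Isomorphism-invariant sums over the deck *)

Lemma isomorphic_refl G : isomorphic G G.
Proof. by exists id => //; exists id. Qed.

Lemma isomorphic_sym G H : isomorphic G H -> isomorphic H G.
Proof.
move=> [f [g fK gK] adjf]; exists g; first by exists f.
by move=> x y; rewrite -adjf !gK.
Qed.

Lemma isomorphic_trans G H K :
  isomorphic G H -> isomorphic H K -> isomorphic G K.
Proof.
move=> [f f_bij adjf] [g g_bij adjg]; exists (g \o f); first exact: bij_comp.
by move=> x y; rewrite /= adjg adjf.
Qed.

Lemma has_split (T : Type) (p : pred T) (s : seq T) :
  has p s -> exists s1 x s2, s = s1 ++ x :: s2 /\ p x.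
Proof.
elim: s => //= a s IHs /orP[pa|/IHs[s1 [x [s2 [-> px]]]]].
  by exists [::], a, s.
by exists (a :: s1), x, s2.
Qed.

(** The head of [s1] is cancelled against an equivalent entry of [s2], which must occur because the
    multiplicities agree. Working up to [e] lets lists of graphs be compared up to isomorphism. *)
Lemma sum_count_equiv (T : Type) (e : rel T) (w : T -> nat) (s1 s2 : seq T) :
    reflexive e -> symmetric e -> transitive e ->
    (forall x y, e x y -> w x = w y) ->
    (forall z, count (e^~ z) s1 = count (e^~ z) s2) ->
  \sum_(x <- s1) w x = \sum_(x <- s2) w x.
Proof.
move=> e_refl e_sym e_trans w_e; elim: s1 s2 => [|x s1 IHs] s2 eq_s.
  by case: s2 eq_s => [|y s2 /(_ y)] //=; rewrite e_refl.
have /has_split[t1 [y [t2 [def_s2 eyx]]]]: has (e^~ x) s2.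
  by rewrite has_count -eq_s /= e_refl.
rewrite def_s2 big_cat !big_cons /= (w_e y x) // addnCA -big_cat /=.
congr (_ + _); apply: IHs => z; move: (eq_s z).
rewrite def_s2 !count_cat /=.
have -> : e x z = e y z.
  by apply/idP/idP; apply: e_trans => //; rewrite e_sym.
lia.
Qed.

Lemma sum_deck (w : sgraph -> nat) (G H : sgraph) :
    (forall K K', isomorphic K K' -> w K = w K') -> deck H =1 deck G ->
  \sum_(S : {set H} | 2 * #|S| <= #|H| + 2) w (induced S) =
  \sum_(S : {set G} | 2 * #|S| <= #|G| + 2) w (induced S).
Proof.
move=> w_iso eqD.
pose small (K : sgraph) := [pred S : {set K} | 2 * #|S| <= #|K| + 2].
have cards (K : sgraph) :
  \sum_(S : {set K} | 2 * #|S| <= #|K| + 2) w (induced S) =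
  \sum_(L <- map (@induced K) (enum (small K))) w L.
  by rewrite big_map big_enum_cond; apply: eq_bigl => S; rewrite inE andbT.
rewrite !cards; apply: (sum_count_equiv (e := isomorphicb)).
- by move=> K; apply/isomorphicP/isomorphic_refl.
- by move=> K L; apply/isomorphicP/isomorphicP => /isomorphic_sym.
- move=> K L M /isomorphicP LK /isomorphicP KM.
  by apply/isomorphicP; apply: isomorphic_trans KM.
- by move=> K L /isomorphicP/w_iso.
move=> K; rewrite !count_map; move: (eqD K); rewrite /deck => eqDK.
have dE (L : sgraph) :
  count (preim (@induced L) (isomorphicb^~ K)) (enum (small L)) =
  #|[set S : {set L} | (2 * #|S| <= #|L| + 2) && isomorphicb (induced S) K]|.
  rewrite -size_filter cardE /enum_mem -filter_predI; congr size.
  by apply: eq_filter => S; rewrite !inE andbC.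
by rewrite !dE.
Qed.

(** The weight picks out the one-vertex cards, and their number is the order of the graph. *)
Lemma deck_card (G H : sgraph) : deck H =1 deck G -> #|H| = #|G|.
Proof.
move=> eqD; pose w (K : sgraph) : nat := #|K| == 1.
have w_iso K K' : isomorphic K K' -> w K = w K'.
  by case=> f /bij_eq_card eqK _; rewrite /w eqK.
have wE (K : sgraph) :
  \sum_(S : {set K} | 2 * #|S| <= #|K| + 2) w (induced S) = #|K|.
  rewrite -[RHS]bin1 -card_draws -sum1dep_card big_mkcond [RHS]big_mkcond /=.
  apply: eq_bigr => S _; rewrite /w card_sig.
  have -> : #|[pred x : K | x \in S]| = #|S| by apply: eq_card.
  case: eqP => [->|_]; last by case: ifP.
  (* A singleton always meets the size bound, since [2 <= #|K| + 2]. *)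
  by rewrite muln1 addnC.
by rewrite -(wE H) -(wE G) (sum_deck w_iso eqD).
Qed.

(** * Counting tuples with a local property *)

(** Invariance under induced embeddings makes [P] depend only on the subgraph induced by the
    vertices of the tuple, hence readable on a card. *)
Definition emb_invariant (I : finType)
    (P : forall G : sgraph, {ffun I -> G} -> G -> G -> bool) :=
  forall (K G : sgraph) (h : K -> G), injective h ->
    (forall x y, adj (h x) (h y) = adj x y) ->
  forall (f : {ffun I -> K}) (y z : K),
    P G [ffun i => h (f i)] (h y) (h z) = P K f y z.

Section Local.
Variables (I : finType).
Variable P : forall G : sgraph, {ffun I -> G} -> G -> G -> bool.
Hypothesis P_inv : emb_invariant P.

Let tup (G : sgraph) := ({ffun I -> G} * G * G)%type.

Let supp (G : sgraph) (t : tup G) : {set G} :=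
  t.1.2 |: (t.2 |: t.1.1 @: [set: I]).

Let sat (G : sgraph) (t : tup G) := P t.1.1 t.1.2 t.2.

Let image_tup (K G : sgraph) (h : K -> G) (t : tup K) : tup G :=
  ([ffun i => h (t.1.1 i)], h t.1.2, h t.2).

(** Requiring full support assigns each tuple of a graph to exactly one vertex set, so no tuple is
    counted on several cards. *)
Let weight (K : sgraph) := #|[set t : tup K | sat t && (supp t == setT)]|.

Let image_tup_inj (K G : sgraph) (h : K -> G) :
  injective h -> injective (image_tup h).
Proof.
move=> h_inj [[f y] z] [[f' y'] z'] /= [/ffunP eqf /h_inj-> /h_inj->].
congr (_, _, _); apply/ffunP => i; apply: h_inj.
by move: (eqf i); rewrite !ffunE.
Qed.

Let supp_image (K G : sgraph) (h : K -> G) t :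
  supp (image_tup h t) = h @: supp t.
Proof.
rewrite /supp !imsetU1 -imset_comp; congr (_ |: (_ |: _)).
by apply: eq_imset => i; rewrite /= ffunE.
Qed.

Let sat_image (K G : sgraph) (h : K -> G) t : injective h ->
  (forall x y, adj (h x) (h y) = adj x y) -> sat (image_tup h t) = sat t.
Proof. by move=> h_inj adjh; apply: P_inv. Qed.

Let weight_iso K K' : isomorphic K K' -> weight K = weight K'.
Proof.
suff le K1 K2 : isomorphic K1 K2 -> weight K1 <= weight K2.
  by move=> iso; apply/eqP; rewrite eqn_leq !le //; apply: isomorphic_sym.
move=> [h h_bij adjh]; have h_inj := bij_inj h_bij.
rewrite /weight -(card_imset _ (image_tup_inj h_inj)); apply: subset_leq_card.
apply/subsetP=> _ /imsetP[t + ->]; rewrite !inE => /andP[Pt /eqP supp_t].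
rewrite supp_image supp_t sat_image // Pt /=.
by case: h_bij => g _ gK; apply/eqP/setP => x; rewrite inE -[x]gK imset_f.
Qed.

Let weight_induced (G : sgraph) (S : {set G}) :
  weight (induced S) = #|[set t : tup G | sat t && (supp t == S)]|.
Proof.
pose inj_v : induced S -> G := val.
have v_inj : injective inj_v by apply: val_inj.
have v_adj x y : adj (inj_v x) (inj_v y) = adj x y by [].
rewrite /weight -(card_imset _ (image_tup_inj v_inj)); apply: eq_card => t.
rewrite inE; apply/imsetP/andP=> [[u + ->]|[Pt /eqP supp_t]].
  rewrite inE sat_image // supp_image => /andP[Pu /eqP->]; split=> //.
  apply/eqP/setP => x; apply/imsetP/idP => [[z _ ->]|Sx]; first exact: valP.
  by exists (Sub x Sx : induced S).
have Sy : t.1.2 \in S by rewrite -supp_t /supp !inE eqxx.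
(* The default of [insubd] must lie in [S]; the entry [t.1.2] of the tuple serves, as it belongs to
   the support. *)
pose v : G -> induced S := insubd (Sub t.1.2 Sy : induced S).
have vK x : x \in S -> inj_v (v x) = x.
  by move=> Sx; rewrite /inj_v val_insubd Sx.
have Sz : t.2 \in S by rewrite -supp_t /supp !inE eqxx orbT.
have Sf i : t.1.1 i \in S by rewrite -supp_t /supp !inE imset_f ?orbT ?inE.
have tE : t = image_tup inj_v (image_tup v t).
  transitivity (t.1.1, t.1.2, t.2); first by case: (t) => [[]].
  rewrite /image_tup /= !vK //; congr (_, _, _).
  by apply/ffunP => i; rewrite !ffunE vK.
exists (image_tup v t) => //; rewrite inE; apply/andP; split.
  by move: Pt; rewrite {1}tE sat_image.
apply/eqP/setP=> x; rewrite in_setT.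
have: inj_v x \in supp t by rewrite supp_t; exact: (valP x).
by rewrite {1}tE supp_image mem_imset.
Qed.

(** Tuples are grouped by support. A support has at most [#|I| + 2] vertices, so it is always the
    vertex set of a card, and [sum_deck] applies to [weight]. *)
Lemma count_local (G H : sgraph) :
    2 * (#|I| + 2) <= #|G| + 2 -> deck H =1 deck G ->
  \sum_(f : {ffun I -> H}) \sum_y \sum_z P f y z =
  \sum_(f : {ffun I -> G}) \sum_y \sum_z P f y z.
Proof.
move=> small eqD; have cardHG := deck_card eqD.
have sumE (K : sgraph) : #|K| = #|G| ->
    \sum_(f : {ffun I -> K}) \sum_y \sum_z P f y z =
    \sum_(S : {set K} | 2 * #|S| <= #|K| + 2) weight (induced S).
  move=> cardK; under eq_bigr do rewrite pair_big.
  rewrite pair_big /=.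
  transitivity #|[set t : tup K | sat t]|.
    rewrite -sum1dep_card [RHS]big_mkcond /=.
    rewrite (reindex (fun t : tup K => (t.1.1, (t.1.2, t.2)))) /=; last first.
      exists (fun t => (t.1, t.2.1, t.2.2)) => [[[f y] z]|[f [y z]]] //.
    by apply: eq_bigr => t _; rewrite /sat; case: P.
  rewrite -sum1dep_card (partition_big (@supp K)
    (fun S => 2 * #|S| <= #|K| + 2)) /=; last first.
    move=> t _; rewrite cardK; apply: leq_trans small; rewrite leq_mul2l /=.
    rewrite addnC -[2]/(1 + 1) -addnA /supp !cardsU1 !leq_add ?leq_b1 //.
    by rewrite -cardsT leq_imset_card.
  by apply: eq_bigr => S _; rewrite weight_induced -sum1dep_card.
by rewrite !sumE // (sum_deck weight_iso eqD).
Qed.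

End Local.

(** * Path automorphisms, matched fibres, and sequences up to reversal *)

(** The first step fixes a direction and [t] can never turn back, so it is affine of slope 1 or -1;
    staying below [r] at both ends then fixes its offset. *)
Lemma path_auto_nat (r : nat) (t : nat -> nat) :
    (forall i, i < r -> t i < r) ->
    (forall i, i.+1 < r -> t i.+1 = (t i).+1 \/ t i = (t i.+1).+1) ->
    (forall i, i.+2 < r -> t i.+2 <> t i) ->
  (forall i, i < r -> t i = i) \/ (forall i, i < r -> t i = r - i.+1).
Proof.
move=> t_lt t_step t_inj.
have [r_le1|r_gt1] := leqP r 1.
  by left=> i lt_i; have := t_lt i lt_i; lia.
have t_last : t r.-1 < r by apply: t_lt; lia.
case: (t_step 0 r_gt1) => t01; [left | right].
  have mono i : i.+1 < r -> t i = t 0 + i /\ t i.+1 = t 0 + i.+1.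
    elim: i => [|i IHi] lt_i; first lia.
    have := IHi (ltnW lt_i); have := t_step _ lt_i; have := t_inj _ lt_i; lia.
  have := mono r.-2; have -> : r.-2.+1 = r.-1 by lia.
  move=> /(_ ltac:(lia))[_ t_end] i lt_i.
  have [->|i_gt0] := posnP i; first lia.
  have := mono i.-1; rewrite prednK //; lia.
have mono i : i.+1 < r -> t i + i = t 0 /\ t i.+1 + i.+1 = t 0.
  elim: i => [|i IHi] lt_i; first lia.
  have := IHi (ltnW lt_i); have := t_step _ lt_i; have := t_inj _ lt_i; lia.
have t0_lt : t 0 < r by apply: t_lt; lia.
have := mono r.-2; have -> : r.-2.+1 = r.-1 by lia.
move=> /(_ ltac:(lia))[_ t_end] i lt_i.
have [->|i_gt0] := posnP i; first lia.
have := mono i.-1; rewrite prednK //; lia.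
Qed.

Lemma path_auto (r : nat) (s : 'I_r -> 'I_r) : injective s ->
    (forall i j, path_adj i j -> path_adj (s i) (s j)) ->
  s =1 id \/ s =1 @rev_ord r.
Proof.
case: r s => [|r] s s_inj s_adj; first by left; case.
pose t k : nat := s (inord k).
have [] := @path_auto_nat r.+1 t.
- by move=> i _; apply: ltn_ord.
- move=> i lt_i; have := s_adj (inord i) (inord i.+1).
  rewrite /path_adj !inordK // ?(ltnW lt_i) // eqxx => /(_ isT)/orP[]/eqP;
  by rewrite /t; lia.
- move=> i lt_i /val_inj/s_inj/(congr1 val); rewrite /= !inordK //; lia.
- move=> tE; left=> i; apply: val_inj.
  by have := tE i (ltn_ord i); rewrite /t inord_val.
- move=> tE; right=> i; apply: val_inj.
  by have := tE i (ltn_ord i); rewrite /t inord_val.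
Qed.

(** The k-th element of each fibre of [p] is sent to the k-th element of the fibre of [q] over the
    same point, in enumeration order. *)
Lemma bij_same_fibers (A B T : finType) (p : A -> T) (q : B -> T) :
    (forall t, #|[set x | p x == t]| = #|[set y | q y == t]|) ->
  exists2 f : A -> B, bijective f & forall x, q (f x) = p x.
Proof.
move=> eq_fib.
pose FA t := enum [set x | p x == t]; pose FB t := enum [set y | q y == t].
have idx_lt x : index x (FA (p x)) < size (FB (p x)).
  by rewrite -cardE -eq_fib cardE index_mem mem_enum inE.
(* A default for [nth]: [B] is not assumed inhabited, but the fibre of [q] over [p x] is nonempty by
   [idx_lt]. *)
have B_of (x : A) : B.
  by case: (FB (p x)) (idx_lt x) => // y.
pose f x := nth (B_of x) (FB (p x)) (index x (FA (p x))).
have qf x : q (f x) = p x.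
  have: f x \in FB (p x) by apply: mem_nth.
  by rewrite mem_enum inE => /eqP.
have f_inj : injective f.
  move=> x y eq_f; have eq_p : p x = p y by rewrite -!qf eq_f.
  move: eq_f; rewrite /f -eq_p (set_nth_default (B_of x)) //; last first.
    by have := idx_lt y; rewrite -eq_p.
  move/eqP; rewrite nth_uniq ?enum_uniq //; last first.
    by have := idx_lt y; rewrite -eq_p.
  by move/eqP/(index_inj x); apply; rewrite /FA mem_enum inE -?eq_p.
exists f => //; apply: inj_card_bij => //.
have sumE (D : finType) (u : D -> T) : #|D| = \sum_t #|[set x | u x == t]|.
  rewrite -cardsT -sum1_card (partition_big u predT) //=.
  apply: eq_bigr => t _; rewrite -sum1dep_card.
  by apply: eq_bigl => x; rewrite inE.
by rewrite (sumE A p) (sumE B q); apply: eq_leq; apply: eq_bigr => t _.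
Qed.

(* The values [D i] and [D (rev_ord i)] are determined as an unordered pair by
   their sum and sum of squares; the mixed products glue these choices. *)
Lemma eq_up_to_rev (r : nat) (D E : 'I_r -> nat) :
    (forall i, D i + D (rev_ord i) = E i + E (rev_ord i)) ->
    (forall i j, D i * D j + D (rev_ord i) * D (rev_ord j) =
                 E i * E j + E (rev_ord i) * E (rev_ord j)) ->
  E =1 D \/ E =1 D \o @rev_ord r.
Proof.
move=> sum1 sum2.
have [/forallP eqED|] := boolP [forall i, E i == D i].
  by left=> i; apply/eqP.
rewrite negb_forall => /existsP[i /eqP neq_i]; right=> j /=.
have pairE k : E k = D k \/ E k = D (rev_ord k).
  have := sum1 k; have := sum2 k k.
  move: (D k) (D (rev_ord k)) (E k) (E (rev_ord k)) => a b c d; nia.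
case: (pairE i) => // Ei; case: (pairE j) => // Ej.
(* Remaining case: the two values are distinct and swapped at [i], but kept at [j]. The mixed
   product gives [(D i - D (rev_ord i)) * (D j - D (rev_ord j)) = 0], so the two values at [j]
   coincide. *)
have := sum1 i; have := sum1 j; have := sum2 i j; move: neq_i Ei Ej.
move: (D i) (D (rev_ord i)) (E i) (E (rev_ord i)) => a b c d.
move: (D j) (D (rev_ord j)) (E j) (E (rev_ord j)) => a' b' c' d'.
move=> neq def_c def_c' sum_ij sum_j sum_i; have def_d' : d' = b' by lia.
have def_d : d = a by lia.
subst c c' d d'; nia.
Qed.

(** * Induced paths and caterpillars spanned by their interiors *)

Lemma degree_sum (G : sgraph) (x : G) : degree x = \sum_y adj x y.
Proof.
rewrite /degree -sum1dep_card big_mkcond.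
by apply: eq_bigr => y _; case: adj.
Qed.

Definition induced_path (k : nat) (G : sgraph) (f : {ffun 'I_k -> G}) : bool :=
  injectiveb f && [forall i, forall j, adj (f i) (f j) == path_adj i j].

(** This is the shift to [i.+1], past both ends of the longer path. Writing it with two lifts gives
    injectivity at once and lets [unlift] invert it. *)
Definition inner (r : nat) (i : 'I_r) : 'I_r.+2 := lift ord0 (lift ord_max i).

Lemma innerE (r : nat) (i : 'I_r) : inner i = i.+1 :> nat.
Proof. by rewrite /inner /= /bump /= leqNgt ltn_ord. Qed.

Arguments inner : simpl never.

Lemma inner_inj (r : nat) : injective (@inner r).
Proof. by move=> i j /lift_inj/lift_inj. Qed.

Lemma inner_rev (r : nat) (i : 'I_r) : inner (rev_ord i) = rev_ord (inner i).
Proof.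
apply: ord_inj; rewrite innerE; transitivity (r.+2 - (inner i).+1) => //.
by rewrite innerE subSS /= subnSK.
Qed.

Section Spine.
Variable r : nat.

Section OneGraph.
Variable G : sgraph.
Implicit Types (f : {ffun 'I_r.+2 -> G}) (u v : G).

Definition spine f (i : 'I_r) : G := f (inner i).

(** The two ends of an induced path [f] count as off the spine. *)
Definition off_spine f u : bool := [forall i, spine f i != u].

Definition spine_nbrs f u : nat := \sum_i adj (spine f i) u.

(** A caterpillar with spine the interior of [f], phrased without connectedness or acyclicity: the
    conditions only involve the path and at most two further vertices. *)
Definition spans_caterpillar f : Prop :=
  [/\ induced_path f,
      forall u v, off_spine f u -> off_spine f v -> ~~ adj u v &
      forall u, off_spine f u -> spine_nbrs f u = 1].

Lemma induced_path_inj f : induced_path f -> injective f.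
Proof. by case/andP => /injectiveP. Qed.

Lemma induced_path_adj f i j :
  induced_path f -> adj (f i) (f j) = path_adj i j.
Proof. by case/andP => _ /forallP/(_ i)/forallP/(_ j)/eqP. Qed.

Lemma spine_inj f : induced_path f -> injective (spine f).
Proof. by move=> pf i j /(induced_path_inj pf)/inner_inj. Qed.

Lemma spine_adj f i j :
  induced_path f -> adj (spine f i) (spine f j) = path_adj i j.
Proof. by move=> pf; rewrite induced_path_adj // /path_adj !innerE. Qed.

Lemma not_off_spine f i : off_spine f (spine f i) = false.
Proof. by apply/negP => /forallP/(_ i)/eqP. Qed.

Lemma off_spinePn f u : reflect (exists i, spine f i = u) (~~ off_spine f u).
Proof.
rewrite negb_forall; apply: (iffP existsP) => -[i].
  by rewrite negbK => /eqP; exists i.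
by move=> <-; exists i; rewrite negbK.
Qed.

Lemma sum_spine f (F : G -> nat) : induced_path f ->
  \sum_u F u = \sum_i F (spine f i) + \sum_(u | off_spine f u) F u.
Proof.
move=> pf; rewrite (bigID (off_spine f)) addnC /=; congr (_ + _).
transitivity (\sum_(u in spine f @: [set: 'I_r]) F u).
  by apply: eq_bigl => u; apply/off_spinePn/imsetP => -[i];
    [move=> <- | move=> _ ->]; exists i.
rewrite big_imset /=; first by apply: eq_bigl => i; rewrite inE.
by move=> i j _ _; apply: spine_inj.
Qed.

Lemma sum_off_spine f : induced_path f -> r + \sum_(u | off_spine f u) 1 = #|G|.
Proof.
move=> pf; rewrite -[in RHS]sum1_card (sum_spine (fun=> 1) pf).
by rewrite big_const_ord iter_addn_0 mul1n.
Qed.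

Lemma degree_spine f i : induced_path f ->
  degree (spine f i) =
  \sum_j path_adj i j + \sum_(u | off_spine f u) adj (spine f i) u.
Proof.
move=> pf; rewrite degree_sum (sum_spine _ pf); congr (_ + _).
by apply: eq_bigr => j _; rewrite spine_adj.
Qed.

(** The edges leaving the spine are counted from their outer ends; the first summand depends on [r]
    alone. *)
Lemma sum_degree_spine f : induced_path f ->
  \sum_i degree (spine f i) =
  \sum_(i < r) \sum_(j < r) path_adj i j
    + \sum_(u | off_spine f u) spine_nbrs f u.
Proof.
move=> pf; under eq_bigr do rewrite degree_spine //.
by rewrite big_split /= [X in _ + X]exchange_big.
Qed.

Definition rev_path f : {ffun 'I_r.+2 -> G} := [ffun i => f (rev_ord i)].

Lemma rev_pathK : involutive rev_path.
Proof. by move=> f; apply/ffunP => i; rewrite !ffunE rev_ordK. Qed.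

Lemma spine_rev f i : spine (rev_path f) i = spine f (rev_ord i).
Proof. by rewrite /spine ffunE inner_rev. Qed.

Lemma induced_path_rev f : induced_path f -> induced_path (rev_path f).
Proof.
move=> pf; apply/andP; split.
  apply/injectiveP=> i j; rewrite !ffunE.
  by move/(induced_path_inj pf)/rev_ord_inj.
apply/forallP=> i; apply/forallP=> j; rewrite !ffunE induced_path_adj //.
by apply/eqP; rewrite /path_adj /=; have := ltn_ord i; have := ltn_ord j; lia.
Qed.

Lemma off_spine_rev f : off_spine (rev_path f) =1 off_spine f.
Proof.
move=> u; apply/forallP/forallP => off i.
  by have := off (rev_ord i); rewrite spine_rev rev_ordK.
by rewrite spine_rev.
Qed.

Lemma spans_caterpillar_rev f :
  spans_caterpillar f -> spans_caterpillar (rev_path f).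
Proof.
case=> pf indep nbrs1; split; first exact: induced_path_rev.
  by move=> u v; rewrite !off_spine_rev; apply: indep.
move=> u; rewrite off_spine_rev => /nbrs1 <-.
rewrite /spine_nbrs (reindex_inj rev_ord_inj) /=.
by apply: eq_bigr => i _; rewrite spine_rev rev_ordK.
Qed.

(** An interior vertex of [g] has two neighbours on [g], whereas a vertex off the spine of [f] has
    only one neighbour in all. So the interior of [g] lies on that of [f], and comparing positions
    gives an automorphism of the path on [r] vertices. *)
Lemma spine_unique f g : spans_caterpillar f -> induced_path g ->
  (forall i, spine g i = spine f i) \/
  (forall i, spine g i = spine f (rev_ord i)).
Proof.
move=> [pf indep nbrs1] pg.
have on_spine i : exists j, spine f j == spine g i.
  have [off|/off_spinePn[j eq_j]] := boolP (off_spine f (spine g i));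
    last by exists j; apply/eqP.
  (* The positions just before and after [inner i], which has value [i.+1]. *)
  pose a : 'I_r.+2 := inord i; pose b : 'I_r.+2 := inord i.+2.
  have [va vb] : a = i :> nat /\ b = i.+2 :> nat.
    by split; rewrite inordK //; have := ltn_ord i; lia.
  have adj_a : adj (g a) (spine g i).
    by rewrite induced_path_adj // /path_adj innerE va eqxx.
  have adj_b : adj (g b) (spine g i).
    by rewrite induced_path_adj // /path_adj innerE vb eqxx orbT.
  have spined v : adj v (spine g i) -> exists j, spine f j = v.
    move=> adj_v; apply/off_spinePn; apply/negP => off_v.
    by have := indep _ _ off_v off; rewrite adj_v.
  have [j eq_j] := spined _ adj_a; have [k eq_k] := spined _ adj_b.
  have neq_jk : k != j.
    apply: contraTneq (isT) => eq_kj; move: eq_k; rewrite eq_kj eq_j.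
    by move/(induced_path_inj pg)/(congr1 val); rewrite /= va vb; lia.
  have := nbrs1 _ off; rewrite /spine_nbrs (bigD1 j) //= (bigD1 k) //=.
  by rewrite eq_j eq_k adj_a adj_b.
pose s i := xchoose (on_spine i).
have sE i : spine f (s i) = spine g i by apply/eqP/(xchooseP (on_spine i)).
have [] := @path_auto r s.
- by move=> i j eq_s; apply: (spine_inj pg); rewrite -!sE eq_s.
- by move=> i j; rewrite -(spine_adj _ _ pg) -(spine_adj _ _ pf) !sE.
- by move=> s_id; left=> i; rewrite -sE s_id.
- by move=> s_rev; right=> i; rewrite -sE s_rev.
Qed.

(* Pairing each path with its reversal removes the choice of a direction. *)
Lemma sum_paths_symm f (F : ('I_r -> G) -> nat) (c : nat) :
    spans_caterpillar f -> (forall x y, x =1 y -> F x = F y) ->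
    F (spine f) + F (fun i => spine f (rev_ord i)) = c ->
  2 * \sum_(g : {ffun 'I_r.+2 -> G} | induced_path g) F (spine g) =
  #|[set g : {ffun 'I_r.+2 -> G} | induced_path g]| * c.
Proof.
move=> cat_f F_ext Fc; have pf : induced_path f by case: cat_f.
rewrite mul2n -addnn [X in _ + X](reindex_inj (inv_inj rev_pathK)) /=.
have rev_iff g : induced_path (rev_path g) = induced_path g.
  by apply/idP/idP => /induced_path_rev; rewrite ?rev_pathK.
rewrite [X in _ + X](eq_bigl _ _ rev_iff) -big_split /=.
rewrite -sum_nat_const [RHS](eq_bigl (@induced_path r.+2 G)); last first.
  by move=> g; rewrite inE.
(* Whichever direction [g] takes, it and its reversal together contribute [c]. *)
apply: eq_bigr => g pg; rewrite -Fc; have [eq_g|eq_g] := spine_unique cat_f pg.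
  congr (_ + _); apply: F_ext => i //.
  by rewrite spine_rev eq_g.
rewrite addnC; congr (_ + _); apply: F_ext => i //.
by rewrite spine_rev eq_g rev_ordK.
Qed.

End OneGraph.

(** Each vertex is labelled by its own spine index or that of its spine neighbour, with a bit
    telling whether it is off the spine. Labels determine adjacency and the spine degrees determine
    the fibre sizes, so a label-preserving bijection is an isomorphism. *)
Lemma isomorphic_caterpillars (G H : sgraph)
    (f : {ffun 'I_r.+2 -> G}) (g : {ffun 'I_r.+2 -> H}) :
    spans_caterpillar f -> spans_caterpillar g ->
    (forall i, degree (spine f i) = degree (spine g i)) ->
  isomorphic G H.
Proof.
have labels (K : sgraph) (h : {ffun 'I_r.+2 -> K}) : spans_caterpillar h ->
    exists lab : K -> 'I_r * bool,
    (forall i, #|[set u | lab u == (i, false)]| = 1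
       /\ #|[set u | lab u == (i, true)]| + \sum_j path_adj i j
          = degree (spine h i))
    /\ forall u v, adj u v =
      match (lab u).2, (lab v).2 with
      | false, false => path_adj (lab u).1 (lab v).1
      | true, true => false
      | _, _ => (lab u).1 == (lab v).1
      end.
  move=> [ph indep nbrs1].
  have root_ex u : exists i : 'I_r,
      if off_spine h u then adj (spine h i) u else spine h i == u.
    have [off|/off_spinePn[i <-]] := boolP (off_spine h u); last by exists i.
    apply/existsP; apply: contraPT (nbrs1 u off) => /existsPn no_i.
    by rewrite /spine_nbrs big1 // => i _; rewrite (negbTE (no_i i)).
  have [root rootP] := fin_all_exists root_ex.
  have root_off u i : off_spine h u -> (root u == i) = adj (spine h i) u.
    move=> off; have := rootP u; rewrite off => adj_u.
    apply/eqP/idP => [<- //|adj_i]; apply/eqP.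
    have := nbrs1 u off; rewrite /spine_nbrs (bigD1 i) //=.
    apply: contra_eqT => neq; rewrite (bigD1 (root u)) //= adj_u adj_i.
    by [].
  have root_spine i : root (spine h i) = i.
    have := rootP (spine h i); rewrite not_off_spine => /eqP.
    exact: spine_inj.
  exists (fun u => (root u, off_spine h u)); split=> [i|u v] /=.
    split.
      apply/eqP/cards1P; exists (spine h i); apply/setP => u; rewrite !inE.
      apply/eqP/eqP => [[<- off_u]|->]; last by rewrite root_spine not_off_spine.
      by have := rootP u; rewrite off_u => /eqP.
    rewrite degree_spine // addnC; congr (_ + _).
    rewrite -sum1dep_card [RHS]big_mkcond [LHS]big_mkcond /=.
    apply: eq_bigr => u _; rewrite xpair_eqE eqb_id.
    case: (boolP (off_spine h u)) => off; last by rewrite andbF.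
    by rewrite root_off // andbT; case: adj.
  have [off_u|/off_spinePn[i <-]] := boolP (off_spine h u);
  have [off_v|/off_spinePn[j <-]] := boolP (off_spine h v).
  - by apply/negbTE/indep.
  - by rewrite root_spine root_off // adj_sym.
  - by rewrite root_spine eq_sym root_off.
  - by rewrite !root_spine spine_adj.
move=> /labels[p [p_fib p_adj]] /labels[q [q_fib q_adj]] eq_deg.
have [|phi phi_bij q_phi] := bij_same_fibers (p := p) (q := q).
  move=> [i []]; last by rewrite (p_fib i).1 (q_fib i).1.
  apply/eqP; rewrite -(eqn_add2r (\sum_j path_adj i j)).
  by rewrite (p_fib i).2 (q_fib i).2 eq_deg.
by exists phi => // u v; rewrite p_adj q_adj !q_phi.
Qed.

End Spine.

(** * Induced paths on [r + 2] vertices in a caterpillar *)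

Section Caterpillar.
Variable G : sgraph.
Hypothesis G_conn : forall x y : G, connect adj x y.
Hypothesis G_gt2 : 2 < #|G|.

Lemma leaf_nbr_unique (u v w : G) :
  degree u = 1 -> adj u v -> adj u w -> v = w.
Proof.
move/eqP/cards1P=> [t tE] uv uw.
have: v \in [set t] by rewrite -tE inE.
have: w \in [set t] by rewrite -tE inE.
by rewrite !inE => /eqP-> /eqP->.
Qed.

Lemma degree_gt0 (u : G) : 0 < degree u.
Proof.
have [v /andP[_ neq_vu]] : exists v, (v \in G) && (v != u).
  apply/existsP; apply: contraLR G_gt2 => /existsPn all_u.
  rewrite -leqNgt; apply: (@leq_trans 1) => //.
  rewrite -(card1 u); apply/subset_leq_card/subsetP => v _.
  by have := all_u v; rewrite /= negbK.
have /connectP[[|w p] /=] := G_conn u v.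
  by move=> _ eq_vu; rewrite eq_vu eqxx in neq_vu.
by move=> /andP[uw _] _; apply/card_gt0P; exists w; rewrite inE.
Qed.

(** Two adjacent leaves would form a connected component on their own, hence the whole graph,
    against [2 < #|G|]. *)
Lemma leaves_indep (u v : G) : degree u = 1 -> degree v = 1 -> ~~ adj u v.
Proof.
move=> deg_u deg_v; apply/negP=> uv; have vu : adj v u by rewrite adj_sym.
have closed_uv : closed adj [set u; v].
  apply: (intro_closed (sym_connect_sym (@adj_sym G))) => x y xy.
  rewrite !inE => /orP[]/eqP eq_x.
    by rewrite eq_x in xy; rewrite (leaf_nbr_unique deg_u xy uv) eqxx orbT.
  by rewrite eq_x in xy; rewrite (leaf_nbr_unique deg_v xy vu) eqxx.
move: G_gt2; apply/negP; rewrite -leqNgt.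
apply: (@leq_trans #|[set u; v]|); last by rewrite cards2; case: eqP.
apply/subset_leq_card/subsetP => x _.
by rewrite -(closed_connect closed_uv (G_conn u x)) !inE eqxx.
Qed.

(** Interior vertices of the path have two neighbours, so they are non-leaves; there being [r] of
    each, the interior is exactly the set of non-leaves. All other vertices are leaves, and their
    only edge must go to the spine. *)
Lemma induced_path_spans (r : nat) (f : {ffun 'I_r.+2 -> G}) :
  #|nonleaves G| = r -> induced_path f -> spans_caterpillar f.
Proof.
move=> card_nl pf.
have spine_nl i : spine f i \in nonleaves G.
  rewrite inE; apply/negP => /eqP deg1.
  pose a : 'I_r.+2 := inord i; pose b : 'I_r.+2 := inord i.+2.
  have [va vb] : a = i :> nat /\ b = i.+2 :> nat.
    by split; rewrite inordK //; have := ltn_ord i; lia.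
  have adj_a : adj (spine f i) (f a).
    by rewrite induced_path_adj // /path_adj innerE va eqxx orbT.
  have adj_b : adj (spine f i) (f b).
    by rewrite induced_path_adj // /path_adj innerE vb eqxx.
  have := leaf_nbr_unique deg1 adj_a adj_b.
  by move/(induced_path_inj pf)/(congr1 val); rewrite /= va vb; lia.
have nlE : spine f @: [set: 'I_r] = nonleaves G.
  apply/eqP; rewrite eqEcard card_nl card_imset ?cardsT ?card_ord ?leqnn.
    by rewrite andbT; apply/subsetP => _ /imsetP[i _ ->].
  exact: spine_inj.
have off_leaf u : off_spine f u -> degree u = 1.
  move=> off; apply/eqP; apply: contraLR off => deg_u.
  have: u \in nonleaves G by rewrite inE.
  rewrite -nlE => /imsetP[i _ ->]; apply/off_spinePn; by exists i.
split=> // [u v /off_leaf deg_u /off_leaf|u off]; first exact: leaves_indep.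
rewrite -(off_leaf _ off) degree_sum (sum_spine _ pf) [X in _ + X]big1.
  by rewrite addn0; apply: eq_bigr => i _; rewrite adj_sym.
move=> v off_v; apply/eqP; rewrite eqb0.
by apply: leaves_indep; apply: off_leaf.
Qed.

(** The spine is extended by one leaf at each end. *)
Lemma longest_induced_path (r : nat) :
    #|nonleaves G| = r ->
    isomorphic (induced (nonleaves G)) (path_graph r) ->
  exists f : {ffun 'I_r.+2 -> G}, induced_path f.
Proof.
move=> card_nl [phi [psi phiK psiK] adj_phi].
pose x (i : 'I_r) : G := val (psi i).
have x_inj : injective x by move=> i j /val_inj /(can_inj psiK).
have x_adj i j : adj (x i) (x j) = path_adj i j.
  rewrite -[RHS]/(adj (i : path_graph r) (j : path_graph r)).
  by rewrite -{2}(psiK i) -{2}(psiK j) adj_phi.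
have x_deg i : 1 < degree (x i).
  have : x i \in nonleaves G by apply: (valP (psi i)).
  by rewrite inE; have := degree_gt0 (x i); case: (degree (x i)) => [|[]].
have xP u : degree u <> 1 -> exists i, u = x i.
  move=> deg_u; have u_nl : u \in nonleaves G by rewrite inE; apply/eqP.
  by exists (phi (Sub u u_nl)); rewrite /x phiK.
have two_nbrs i : exists u v, [/\ adj (x i) u, adj (x i) v & u != v].
  by have /card_gt1P[u [v []]] := x_deg i; rewrite !inE => xu xv; exists u, v.
case: r => [|r] in phi psi phiK psiK adj_phi card_nl x x_inj x_adj x_deg
  xP two_nbrs *.
  (* An empty spine is impossible: all vertices would be leaves, yet some two are adjacent. *)
  have /card_gt0P[u _] : 0 < #|G| by apply: leq_trans G_gt2.
  have leaf (w : G) : degree w = 1.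
    by case: (degree w =P 1) => // /xP[i _]; case: i.
  have /card_gt0P[v] := degree_gt0 u; rewrite inE.
  by rewrite (negbTE (leaves_indep (leaf u) (leaf v))).
have [a [b [neq_ab deg_a deg_b adj_a adj_b]]] : exists a b,
    [/\ a != b, degree a = 1, degree b = 1, adj (x ord0) a & adj (x ord_max) b].
  case: r => [|r] in phi psi phiK psiK adj_phi card_nl x x_inj x_adj x_deg
    xP two_nbrs *.
    (* A single spine vertex is both ends at once; its two distinct neighbours are leaves. *)
    have leaf u : adj (x ord0) u -> degree u = 1.
      move=> xu; case: (degree u =P 1) => // /xP[i def_u].
      by move: xu; rewrite def_u x_adj; case: i {def_u} => [[]].
    have [u [v [xu xv neq_uv]]] := two_nbrs ord0; exists u, v.
    by split=> //; rewrite ?leaf //; rewrite (ord1 ord_max).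
  (* An end of a longer spine has two neighbours, at most one of them on the spine. *)
  have end_leaf i : (forall j k, path_adj i j -> path_adj i k -> j = k) ->
      exists2 u, degree u = 1 & adj (x i) u.
    move=> i_end; have [u [v [xu xv /eqP neq_uv]]] := two_nbrs i.
    have [deg_u|/xP[j def_u]] := degree u =P 1; first by exists u.
    have [deg_v|/xP[k def_v]] := degree v =P 1; first by exists v.
    case: neq_uv; rewrite def_u def_v (i_end j k) //.
      by rewrite -x_adj -def_u.
    by rewrite -x_adj -def_v.
  have [j k|a deg_a adj_a] := end_leaf ord0.
    by rewrite /path_adj /= => jE kE; apply: ord_inj; lia.
  have [j k|b deg_b adj_b] := end_leaf ord_max.
    rewrite /path_adj /= => jE kE; apply: ord_inj.
    by have := ltn_ord j; have := ltn_ord k; lia.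
  (* A common leaf would have both ends of the spine as neighbours, and these differ here. *)
  exists a, b; split=> //; apply: contraTneq isT => eq_ab.
  have ax : adj a (x ord0) by rewrite adj_sym.
  have ay : adj a (x ord_max) by rewrite eq_ab adj_sym.
  by have /x_inj/(congr1 val) := leaf_nbr_unique deg_a ax ay.
have adj_ax j : adj a (x j) = (j == ord0).
  apply/idP/eqP => [aj|->]; last by rewrite adj_sym.
  by apply: x_inj; apply: (leaf_nbr_unique deg_a); rewrite // adj_sym.
have adj_bx j : adj b (x j) = (j == ord_max).
  apply/idP/eqP => [bj|->]; last by rewrite adj_sym.
  by apply: x_inj; apply: (leaf_nbr_unique deg_b); rewrite // adj_sym.
have adj_ab : adj a b = false by apply/negbTE/leaves_indep.
have leaf_x u j : degree u = 1 -> u <> x j.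
  by move=> deg_u def_u; have := x_deg j; rewrite -def_u deg_u.
(* The sequence [a], the spine, [b]; the nested [unlift] undoes [inner]. *)
pose f : {ffun 'I_r.+3 -> G} := [ffun k : 'I_r.+3 =>
  if unlift ord0 k is Some k' then
    if unlift ord_max k' is Some j then x j else b
  else a].
have f0 : f ord0 = a by rewrite ffunE unlift_none.
have fx j : f (inner j) = x j by rewrite ffunE !liftK.
have fl : f ord_max = b.
  have -> : ord_max = lift ord0 ord_max :> 'I_r.+3 by apply: val_inj.
  by rewrite ffunE liftK unlift_none.
have ordP (k : 'I_r.+3) : [\/ k = ord0, k = ord_max | exists j, k = inner j].
  have [k' ->|->] := unliftP ord0 k; last by constructor 1.
  have [j ->|->] := unliftP ord_max k'; first by constructor 3; exists j.
  by constructor 2; apply: val_inj.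
exists f; apply/andP; split.
  apply/injectiveP => k l.
  have [->|->|[i ->]] := ordP k; have [->|->|[j ->]] := ordP l;
    rewrite ?f0 ?fl ?fx //.
  - by move/eqP; rewrite (negbTE neq_ab).
  - by move/leaf_x; case.
  - by move/eqP; rewrite eq_sym (negbTE neq_ab).
  - by move/leaf_x; case.
  - by move/esym/leaf_x; case.
  - by move/esym/leaf_x; case.
  - by move/x_inj->.
apply/forallP=> k; apply/forallP=> l; apply/eqP.
have [->|->|[i ->]] := ordP k; have [->|->|[j ->]] := ordP l;
  rewrite ?f0 ?fl ?fx ?x_adj ?adj_irrefl ?adj_ab ?[adj b a]adj_sym ?adj_ab
    ?[adj (x _) _]adj_sym ?adj_ax ?adj_bx /path_adj ?innerE -?val_eqE /=;
  try (have := ltn_ord i); try (have := ltn_ord j); lia.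
Qed.

End Caterpillar.

Lemma caterpillar_paths (G : sgraph) (r : nat) :
    is_caterpillar G -> #|nonleaves G| = r -> 2 < #|G| ->
  (exists f : {ffun 'I_r.+2 -> G}, induced_path f) /\
  forall f : {ffun 'I_r.+2 -> G}, induced_path f -> spans_caterpillar f.
Proof.
move=> [[[_ G_conn] _] [k iso_k]] card_nl G_gt2; split; last first.
  by move=> f; apply: induced_path_spans.
have def_k : k = r.
  have [phi phi_bij _] := iso_k.
  have := bij_eq_card phi_bij; rewrite card_ord card_sig => <-.
  by rewrite -card_nl; apply: eq_card.
by apply: longest_induced_path; rewrite // -def_k.
Qed.

(** * Transfer from [G] to [H] *)

Section Transfer.
Variables (r : nat) (G H : sgraph).
Hypothesis small : r + 4 <= (#|G| + 2) %/ 2.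
Hypothesis eqD : deck H =1 deck G.

Let npaths (K : sgraph) :=
  #|[set f : {ffun 'I_r.+2 -> K} | induced_path f]|.

Lemma spine_map (K L : sgraph) (h : K -> L) (f : {ffun 'I_r.+2 -> K}) i :
  spine [ffun i => h (f i)] i = h (spine f i).
Proof. by rewrite /spine ffunE. Qed.

Lemma off_spine_map (K L : sgraph) (h : K -> L) (f : {ffun 'I_r.+2 -> K}) u :
  injective h -> off_spine [ffun i => h (f i)] (h u) = off_spine f u.
Proof.
by move=> h_inj; apply: eq_forallb => i; rewrite spine_map (inj_eq h_inj).
Qed.

Lemma induced_path_map (K L : sgraph) (h : K -> L) (f : {ffun 'I_r.+2 -> K}) :
    injective h -> (forall x y, adj (h x) (h y) = adj x y) ->
  induced_path [ffun i => h (f i)] = induced_path f.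
Proof.
move=> h_inj adjh; congr (_ && _).
  apply/injectiveP/injectiveP => f_inj i j.
    by move=> eq_f; apply: f_inj; rewrite !ffunE eq_f.
  by rewrite !ffunE => /h_inj/f_inj.
by apply: eq_forallb => i; apply: eq_forallb => j; rewrite !ffunE adjh.
Qed.

Lemma path_count_local
    (Q : forall K : sgraph, {ffun 'I_r.+2 -> K} -> K -> K -> bool) :
    emb_invariant Q ->
  \sum_(f : {ffun 'I_r.+2 -> H} | induced_path f) \sum_y \sum_z Q H f y z =
  \sum_(f : {ffun 'I_r.+2 -> G} | induced_path f) \sum_y \sum_z Q G f y z.
Proof.
move=> Q_inv; rewrite big_mkcond [RHS]big_mkcond /=.
pose P K f y z := induced_path f && Q K f y z.
have P_inv : emb_invariant P.
  by move=> K L h h_inj adjh f y z; rewrite /P induced_path_map // Q_inv.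
have PE (K : sgraph) :
    \sum_(f : {ffun 'I_r.+2 -> K})
      (if induced_path f then \sum_y \sum_z Q K f y z else 0) =
    \sum_f \sum_y \sum_z P K f y z.
  apply: eq_bigr => f _; rewrite /P; case: induced_path => //.
  by rewrite big1 // => y _; rewrite big1.
rewrite !PE; apply: (count_local P_inv) => //.
by rewrite card_ord; have := small; lia.
Qed.

(** The counts are sums of nonnegative terms, so a zero total in [G] makes every term in [H]
    vanish. *)
Lemma path_no_local
    (Q : forall K : sgraph, {ffun 'I_r.+2 -> K} -> K -> K -> bool) :
    emb_invariant Q ->
    (forall (f : {ffun 'I_r.+2 -> G}) y z, induced_path f -> ~~ Q G f y z) ->
  forall (f : {ffun 'I_r.+2 -> H}) y z, induced_path f -> ~~ Q H f y z.
Proof.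
move=> Q_inv noQ f y z pf; have := path_count_local Q_inv.
rewrite [RHS]big1 => [/eqP|g pg]; last first.
  rewrite big1 // => y' _; rewrite big1 // => z' _.
  by rewrite (negbTE (noQ _ _ _ pg)).
rewrite sum_nat_eq0 => /forallP/(_ f); rewrite pf sum_nat_eq0.
move=> /forallP/(_ y); rewrite sum_nat_eq0 => /forallP/(_ z) /=.
by rewrite eqb0.
Qed.

(** Local counts always carry two extra vertices; a condition on one vertex is encoded by forcing
    the second to equal it. *)
Lemma sum1_diag (K : sgraph) (p : K -> bool) :
  \sum_y \sum_z (p y && (z == y)) = \sum_y p y.
Proof.
apply: eq_bigr => y _; rewrite (bigD1 y) //= eqxx andbT big1 ?addn0 // => z.
by move/negbTE->; rewrite andbF.
Qed.

(** Both extra vertices are pinned to the first vertex of the path, so each path counts once. *)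
Lemma npaths_eq : npaths H = npaths G.
Proof.
pose Q (K : sgraph) (f : {ffun 'I_r.+2 -> K}) (y z : K) :=
  (y == f ord0) && (z == y).
have Q_inv : emb_invariant Q.
  by move=> K L h h_inj adjh f y z; rewrite /Q ffunE !(inj_eq h_inj).
have := path_count_local Q_inv.
have QE (K : sgraph) (f : {ffun 'I_r.+2 -> K}) : \sum_y \sum_z Q K f y z = 1.
  rewrite sum1_diag (bigD1 (f ord0)) //= eqxx big1 // => y.
  by move/negbTE->.
under eq_bigr do rewrite QE; under [X in _ = X -> _]eq_bigr do rewrite QE.
by rewrite !sum1dep_card.
Qed.

Lemma sum_degree_eq i :
  \sum_(f : {ffun 'I_r.+2 -> H} | induced_path f) degree (spine f i) =
  \sum_(f : {ffun 'I_r.+2 -> G} | induced_path f) degree (spine f i).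
Proof.
pose Q (K : sgraph) (f : {ffun 'I_r.+2 -> K}) (y z : K) :=
  adj (spine f i) y && (z == y).
have Q_inv : emb_invariant Q.
  by move=> K L h h_inj adjh f y z; rewrite /Q spine_map adjh (inj_eq h_inj).
under eq_bigr do rewrite degree_sum -sum1_diag.
rewrite (path_count_local Q_inv).
by apply: eq_bigr => f _; rewrite sum1_diag degree_sum.
Qed.

(** The two extra vertices range independently over the neighbours of the two spine vertices, which
    yields the product of degrees. *)
Lemma sum_degree2_eq i j :
  \sum_(f : {ffun 'I_r.+2 -> H} | induced_path f)
     degree (spine f i) * degree (spine f j) =
  \sum_(f : {ffun 'I_r.+2 -> G} | induced_path f)
     degree (spine f i) * degree (spine f j).
Proof.
pose Q (K : sgraph) (f : {ffun 'I_r.+2 -> K}) (y z : K) :=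
  adj (spine f i) y && adj (spine f j) z.
have Q_inv : emb_invariant Q.
  by move=> K L h h_inj adjh f y z; rewrite /Q !spine_map !adjh.
have QE (K : sgraph) (f : {ffun 'I_r.+2 -> K}) :
    degree (spine f i) * degree (spine f j) = \sum_y \sum_z Q K f y z.
  rewrite !degree_sum big_distrl; apply: eq_bigr => y _.
  by rewrite big_distrr; apply: eq_bigr => z _; rewrite /Q /=; do 2!case: adj.
under eq_bigr do rewrite QE; rewrite (path_count_local Q_inv).
by apply: eq_bigr => f _; rewrite QE.
Qed.

Hypothesis spansG :
  forall f : {ffun 'I_r.+2 -> G}, induced_path f -> spans_caterpillar f.

(** An outside vertex with two spine neighbours is a local configuration that [G] excludes around
    all its induced paths, so [H] excludes it too. *)
Lemma spine_nbrs_le1 (f : {ffun 'I_r.+2 -> H}) u :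
  induced_path f -> off_spine f u -> spine_nbrs f u <= 1.
Proof.
move=> pf off; have [/existsP[i adj_i]|/existsPn no_adj] :=
  boolP [exists i, adj (spine f i) u]; last first.
  by rewrite /spine_nbrs big1 // => i _; rewrite (negbTE (no_adj i)).
rewrite /spine_nbrs (bigD1 i) //= adj_i big1 // => j neq_ji.
pose Q (K : sgraph) (f : {ffun 'I_r.+2 -> K}) (y z : K) :=
  [&& off_spine f y, adj (spine f i) y & adj (spine f j) y].
have Q_inv : emb_invariant Q.
  by move=> K L h h_inj adjh g y z; rewrite /Q !spine_map !adjh off_spine_map.
apply/eqP; rewrite eqb0.
have := path_no_local Q_inv _ u u pf; rewrite /Q off adj_i /=; apply.
move=> g y _ /spansG[_ _ nbrs1]; apply/negP => /and3P[off_y yi yj].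
have := nbrs1 y off_y.
by rewrite /spine_nbrs (bigD1 i) //= (bigD1 j) //= yi yj.
Qed.

Lemma off_spine_indep (f : {ffun 'I_r.+2 -> H}) u v :
  induced_path f -> off_spine f u -> off_spine f v -> ~~ adj u v.
Proof.
move=> pf off_u off_v.
pose Q (K : sgraph) (f : {ffun 'I_r.+2 -> K}) (y z : K) :=
  [&& off_spine f y, off_spine f z & adj y z].
have Q_inv : emb_invariant Q.
  by move=> K L h h_inj adjh g y z; rewrite /Q !adjh !off_spine_map.
have := path_no_local Q_inv _ u v pf; rewrite /Q off_u off_v /=; apply.
move=> g y z /spansG[_ indep _]; apply/negP => /and3P[off_y off_z].
by apply/negP; apply: indep.
Qed.

(* A vertex of H off the spine has at most one neighbour on it. If some had
   none, the spine degrees, summed over all paths, would fall short of the sum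
   in G. *)
Lemma spans_transfer (f : {ffun 'I_r.+2 -> H}) :
  induced_path f -> spans_caterpillar f.
Proof.
move=> pf; split=> // [u v|u off]; first exact: off_spine_indep.
apply: contraTeq (isT) => neq1; exfalso.
pose S (K : sgraph) (g : {ffun 'I_r.+2 -> K}) := \sum_i degree (spine g i).
pose B := \sum_(i < r) \sum_(j < r) path_adj i j.
have sumS : \sum_(g | induced_path g) S H g = \sum_(g | induced_path g) S G g.
  rewrite exchange_big [RHS]exchange_big.
  by apply: eq_bigr => i _; apply: sum_degree_eq.
have offE (K : sgraph) (g : {ffun 'I_r.+2 -> K}) : induced_path g ->
    \sum_(v | off_spine g v) 1 = #|K| - r.
  by move=> pg; rewrite -(sum_off_spine pg) addKn.
have SG (g : {ffun 'I_r.+2 -> G}) : induced_path g -> S G g = B + (#|G| - r).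
  move=> pg; rewrite /S sum_degree_spine // -(offE _ _ pg); congr (_ + _).
  by apply: eq_bigr => v; have [_ _ /(_ v)] := spansG pg.
have SH (g : {ffun 'I_r.+2 -> H}) : induced_path g -> S H g <= B + (#|G| - r).
  move=> pg; rewrite /S sum_degree_spine // -(deck_card eqD) -(offE _ _ pg).
  by rewrite leq_add2l; apply: leq_sum => v; apply: spine_nbrs_le1.
(* The vertex [u] contributes 0 instead of 1, which makes the bound strict for [f]. *)
have Sf : S H f < B + (#|G| - r).
  rewrite /S sum_degree_spine // -(deck_card eqD) -(offE _ _ pf) ltn_add2l.
  rewrite (bigD1 u) //= [X in _ < X](bigD1 u) //= -addSn leq_add //.
    by rewrite ltn_neqAle neq1 spine_nbrs_le1.
  by apply: leq_sum => v /andP[off_v _]; apply: spine_nbrs_le1.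
move/eqP: sumS; rewrite ltn_eqF // (eq_bigr _ SG).
(* Since [H] and [G] have equally many paths, the constant sum over [G] becomes one over [H], to be
   compared term by term with strictness at [f]. *)
rewrite [X in _ < X]sum_nat_cond_const -/(npaths G) -npaths_eq /npaths.
rewrite -sum_nat_cond_const (bigD1 f) //= [X in _ < X](bigD1 f) //= -addSn.
by rewrite leq_add //; apply: leq_sum => g /andP[pg _]; apply: SH.
Qed.

End Transfer.

(** * Reconstruction from the spine degrees *)

Theorem theorem2p2 (G : sgraph) (n r : nat) (hn : #|G| = n)
    (hG : is_caterpillar G) (hr : #|nonleaves G| = r)
    (hrn : 2 * r + 6 <= n) (H : sgraph) (hD : deck H =1 deck G) :
  isomorphic H G.
Proof.
(* Room for the [r + 2] vertices of a path and two extra ones on one card. *)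
have small : r + 4 <= (#|G| + 2) %/ 2 by lia.
have [[f pf] spansG] : _ := caterpillar_paths hG hr ltac:(lia).
have spansH := spans_transfer small hD spansG.
have eq_npaths := npaths_eq small hD.
have npathsG : 0 < #|[set f : {ffun 'I_r.+2 -> G} | induced_path f]|.
  by apply/card_gt0P; exists f; rewrite inE.
have npathsH := npathsG; rewrite -eq_npaths in npathsH.
have /card_gt0P[g] := npathsH; rewrite inE => pg.
have [cat_f cat_g] := (spansG f pf, spansH g pg).
pose D i := degree (spine f i); pose E i := degree (spine g i).
(* Twice each sum over paths is the number of paths times a symmetrised value; this number is
   positive and common to [G] and [H], so it cancels. *)
have sumD1 i : D i + D (rev_ord i) = E i + E (rev_ord i).
  have eqG := sum_paths_symm (F := fun x => degree (x i)) cat_f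
    (fun x y eq_xy => congr1 (@degree G) (eq_xy i)) erefl.
  have eqH := sum_paths_symm (F := fun x => degree (x i)) cat_g
    (fun x y eq_xy => congr1 (@degree H) (eq_xy i)) erefl.
  apply/eqP; rewrite -(eqn_pmul2l npathsG) -eqG -eq_npaths -eqH.
  by rewrite (sum_degree_eq small hD).
have sumD2 i j : D i * D j + D (rev_ord i) * D (rev_ord j) =
                 E i * E j + E (rev_ord i) * E (rev_ord j).
  have ext (K : sgraph) (x y : 'I_r -> K) : x =1 y ->
      degree (x i) * degree (x j) = degree (y i) * degree (y j).
    by move=> eq_xy; rewrite !eq_xy.
  have eqG := sum_paths_symm cat_f (ext G) erefl.
  have eqH := sum_paths_symm cat_g (ext H) erefl.
  apply/eqP; rewrite -(eqn_pmul2l npathsG) -eqG -eq_npaths -eqH.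
  by rewrite (sum_degree2_eq small hD).
have [eqED|eqED] := eq_up_to_rev sumD1 sumD2.
  exact: (isomorphic_caterpillars cat_g cat_f).
(* If the degrees match in reverse order, the path of [G] is traversed backwards. *)
apply: (isomorphic_caterpillars cat_g (spans_caterpillar_rev cat_f)) => i.
by rewrite spine_rev -/(E i) eqED.
Qed.
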